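(* Let $\Lambda$ be a finite dimensional $(n,p)$-eventually periodic algebra over a field $k$. Then $$\operatorname{Fin.dim} \Lambda \leq n \quad \text{and} \quad \operatorname{Fin.dim} \Lambda^{\mathrm{op}} \leq n.$$
   Context: Rings are associative and unital; modules are left modules (not necessarily finitely generated). The big finitistic dimension of an algebra $A$ is $\operatorname{Fin.dim} A=\sup\{\operatorname{proj.dim}_A M\mid M \text{ an } A\text{-module with } \operatorname{proj.dim}_A M<\infty\}$. $\Lambda^{\mathrm e}=\Lambda\otimes_k\Lambda^{\mathrm{op}}$; $\Lambda^{\mathrm e}$-modules are identified with $\Lambda$-bimodules on which $k$ acts centrally. For a finite dimensional algebra $A$ and an $A$-module $M$, the syzygy $\Omega_A(M)$ is the kernel of a projective cover of $M$, $\Omega_A^0(M)=M$ and $\Omega_A^n(M)=\Omega_A(\Omega_A^{n-1}(M))$. $M$ is periodic if $\Omega_A^p(M)\cong M$ as $A$-modules for some $p>0$; the smallest such $p$ is its period. $M$ is $(n,p)$-eventually periodic if $n$ is the smallest non-negative integer such that $\Omega_A^n(M)$ is periodic, and $\Omega_A^n(M)$ has period $p$. The algebra $\Lambda$ is $(n,p)$-eventually periodic if the regular bimodule $\Lambda$ is $(n,p)$-eventually periodic as a $\Lambda^{\mathrm e}$-module. *)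

(* Defs.v *)
From HB Require Import structures.
From mathcomp Require Import all_boot all_order all_algebra all_field.
From mathcomp Require Import boolp classical_sets constructive_ereal.

Set Implicit Arguments.
Unset Strict Implicit.
Unset Printing Implicit Defensive.

Import Order.TTheory GRing.Theory Num.Theory.

Local Open Scope ring_scope.

(* Mathcomp provides the opposite ring A^c, with x * y in A^c equal to y * x  *)
(* in A, but not its algebra structure over the base field.                   *)

HB.instance Definition _ (k : fieldType) (V : lmodType k) :=
  GRing.Lmodule.on V^c.

HB.instance Definition _ (k : fieldType) (V : vectType k) := Vector.on V^c.

Section ConverseAlgebra.
Variables (k : fieldType) (A : algType k).

HB.instance Definition _ := GRing.Lmodule_isLalgebra.Build k A^c
  (fun c u v => @scalerAr k A c v u).
HB.instance Definition _ := GRing.Lalgebra_isAlgebra.Build k A^c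
  (fun c u v => @scalerAl k A c v u).

End ConverseAlgebra.

HB.instance Definition _ (k : fieldType) (A : falgType k) :=
  Algebra_isFalgebra.Build k A^c.

(* The tensor product of two finite dimensional algebras over k. An element   *)
(* is given by its coordinates on the family e_i (x) f_j, where e and f are   *)
(* the bases vbasis {:A} and vbasis {:B}; the universal property is           *)
(* tensor_lift_tens together with tensor_ext.                                 *)

Section Tensor.
Variables (k : fieldType) (A B : falgType k).

Definition tensor : Type := 'M[k]_(\dim {:A}, \dim {:B}).
HB.instance Definition _ := Vector.on tensor.

Definition tens (a : A) (b : B) : tensor :=
  \matrix_(i, j) (coord (vbasis {:A}) i a * coord (vbasis {:B}) j b).

Definition bilinear2 (C : lmodType k) (phi : A -> B -> C) :=
  (forall b, linear (phi^~ b)) /\ (forall a, linear (phi a)).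

Definition tensor_lift (C : lmodType k) (phi : A -> B -> C) (t : tensor) : C :=
  \sum_i \sum_j t i j *: phi (vbasis {:A})`_i (vbasis {:B})`_j.

Lemma tensor_lift_linear (C : lmodType k) (phi : A -> B -> C) :
  linear (tensor_lift phi).
Proof.
move=> c s t; rewrite /tensor_lift scaler_sumr -big_split; apply: eq_bigr => i _.
rewrite scaler_sumr -big_split; apply: eq_bigr => j _.
by rewrite !mxE scalerDl scalerA.
Qed.

Lemma linear_comb_sum (U V : lmodType k) (f : U -> V) (n : nat) (c : 'I_n -> k)
    (u : 'I_n -> U) :
  linear f -> f (\sum_i c i *: u i) = \sum_i c i *: f (u i).
Proof.
move=> lf; pose mf := GRing.isLinear.Build k U V *:%R f lf.
pose F : {linear U -> V} := HB.pack f mf.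
by rewrite -[f]/(F : U -> V) linear_sum; apply: eq_bigr => i _; rewrite linearZ.
Qed.

Lemma tens_bilinear : bilinear2 tens.
Proof.
split=> [b c x y | a c x y]; apply/matrixP=> i j; rewrite !mxE linearP /=.
  by rewrite mulrDl mulrA.
by rewrite mulrDr mulrCA.
Qed.

Lemma tensor_lift_tens (C : lmodType k) (phi : A -> B -> C) a b :
  bilinear2 phi -> tensor_lift phi (tens a b) = phi a b.
Proof.
case=> phil phir.
rewrite [in RHS](coord_vbasis (memvf a)) (linear_comb_sum _ _ (phil b)).
apply: eq_bigr => i _.
rewrite [in RHS](coord_vbasis (memvf b)) (linear_comb_sum _ _ (phir _)).
rewrite scaler_sumr; apply: eq_bigr => j _.
by rewrite mxE scalerA.
Qed.

Lemma tensor_decomp (t : tensor) :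
  t = \sum_i \sum_j t i j *: tens (vbasis {:A})`_i (vbasis {:B})`_j.
Proof.
apply/matrixP=> p q; rewrite summxE (bigD1 p) //= summxE (bigD1 q) //= !mxE.
have fA := basis_free (vbasisP {:A}); have fB := basis_free (vbasisP {:B}).
rewrite !coord_free // !eqxx !mulr1 !big1 ?addr0 //.
  move=> i /negPf ip; rewrite summxE big1 // => j _.
  by rewrite !mxE !coord_free // ip mul0r mulr0.
move=> j /negPf jq.
by rewrite !mxE !coord_free // jq !mulr0.
Qed.

Lemma tensor_ext (C : lmodType k) (f g : tensor -> C) :
  linear f -> linear g -> (forall a b, f (tens a b) = g (tens a b)) -> f =1 g.
Proof.
move=> lf lg fg t; rewrite [t]tensor_decomp.
pose mf := GRing.isLinear.Build k _ C *:%R f lf.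
pose F : {linear tensor -> C} := HB.pack f mf.
pose mg := GRing.isLinear.Build k _ C *:%R g lg.
pose G : {linear tensor -> C} := HB.pack g mg.
rewrite -[f]/(F : _ -> _) -[g]/(G : _ -> _) !linear_sum; apply: eq_bigr => i _.
rewrite !linear_sum; apply: eq_bigr => j _; rewrite !linearZ; congr (_ *: _).
exact: fg.
Qed.

Lemma tensor_lift_comb (C : lmodType k) c (phi psi : A -> B -> C) t :
  tensor_lift (fun a b => c *: phi a b + psi a b) t =
  c *: tensor_lift phi t + tensor_lift psi t.
Proof.
rewrite /tensor_lift scaler_sumr -big_split; apply: eq_bigr => i _.
rewrite scaler_sumr -big_split; apply: eq_bigr => j _.
by rewrite scalerDr !scalerA mulrC.
Qed.

Lemma eq_tensor_lift (C : lmodType k) (phi psi : A -> B -> C) t :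
  (forall a b, phi a b = psi a b) -> tensor_lift phi t = tensor_lift psi t.
Proof.
by move=> e; apply: eq_bigr => i _; apply: eq_bigr => j _; rewrite e.
Qed.

Definition tensor_one : tensor := tens 1 1.
Definition tensor_mul (s t : tensor) : tensor :=
  tensor_lift
    (fun a b => tensor_lift (fun a' b' => tens (a * a') (b * b')) t) s.

Lemma tensor_mul_inner a b :
  bilinear2 (fun a' b' => tens (a * a') (b * b')).
Proof.
have [l r] := tens_bilinear.
by split=> [b' c x y | a' c x y]; rewrite mulrDr -scalerAr ?l ?r.
Qed.

Lemma tensor_mul_outer t :
  bilinear2 (fun a b => tensor_lift (fun a' b' => tens (a * a') (b * b')) t).
Proof.
have [l r] := tens_bilinear.
split=> [b c x y | a c x y]; rewrite -tensor_lift_comb;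
  apply: eq_tensor_lift => a' b'; rewrite mulrDl -scalerAl ?l ?r //.
Qed.

Lemma tensor_mul_tens a b a' b' :
  tensor_mul (tens a b) (tens a' b') = tens (a * a') (b * b').
Proof.
rewrite /tensor_mul tensor_lift_tens; last exact: tensor_mul_outer.
by rewrite tensor_lift_tens //; apply: tensor_mul_inner.
Qed.

Lemma tensor_mul_linearl t : linear (tensor_mul^~ t).
Proof. exact: tensor_lift_linear. Qed.

Lemma tensor_mul_linearr s : linear (tensor_mul s).
Proof.
move=> c x y; rewrite /tensor_mul -tensor_lift_comb.
by apply: eq_tensor_lift => a b; rewrite tensor_lift_linear.
Qed.

Lemma linear_comp (U V W : lmodType k) (f : V -> W) (g : U -> V) :
  linear f -> linear g -> linear (fun x => f (g x)).
Proof. by move=> lf lg c x y; rewrite lg lf. Qed.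

Lemma tensor_mulA : associative tensor_mul.
Proof.
move=> x y z.
have H1 : forall b c d e, tensor_mul (tens b c) (tensor_mul (tens d e) z) =
  tensor_mul (tensor_mul (tens b c) (tens d e)) z.
  move=> a b c d; move: z; apply: tensor_ext.
  - by apply: linear_comp; apply: tensor_mul_linearr.
  - exact: tensor_mul_linearr.
  - by move=> u v; rewrite !tensor_mul_tens !mulrA.
have H2 : forall b c, tensor_mul (tens b c) (tensor_mul y z) =
  tensor_mul (tensor_mul (tens b c) y) z.
  move=> a b; move: y; apply: tensor_ext.
  - exact: (linear_comp (tensor_mul_linearr _) (tensor_mul_linearl _)).
  - exact: (linear_comp (tensor_mul_linearl _) (tensor_mul_linearr _)).
  - by move=> u v; rewrite H1.
move: x; apply: tensor_ext => //.
- exact: tensor_mul_linearl.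
- exact: (linear_comp (tensor_mul_linearl _) (tensor_mul_linearl _)).
Qed.

Lemma linear_id (U : lmodType k) : linear (fun x : U => x).
Proof. by []. Qed.

Lemma tensor_mul1l : left_id tensor_one tensor_mul.
Proof.
apply: tensor_ext => [||a b]; [exact: tensor_mul_linearr | exact: linear_id |].
by rewrite tensor_mul_tens !mul1r.
Qed.

Lemma tensor_mul1r : right_id tensor_one tensor_mul.
Proof.
apply: tensor_ext => [||a b]; [exact: tensor_mul_linearl | exact: linear_id |].
by rewrite tensor_mul_tens !mulr1.
Qed.

Lemma tensor_mulDl : left_distributive tensor_mul +%R.
Proof.
by move=> x y z; have := tensor_mul_linearl z 1 x y; rewrite !scale1r.
Qed.

Lemma tensor_mulDr : right_distributive tensor_mul +%R.
Proof.
by move=> x y z; have := tensor_mul_linearr x 1 y z; rewrite !scale1r.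
Qed.

Lemma coord_one_neq0 (C : falgType k) :
  exists i, coord (vbasis {:C}) i (1 : C) != 0.
Proof.
apply/existsP; apply: contraT; rewrite negb_exists => /forallP h.
case/eqP: (oner_neq0 C); rewrite (coord_vbasis (memvf (1 : C))) big1 // => i _.
by rewrite (eqP (negPn (h i))) scale0r.
Qed.

Lemma tensor_one_neq0 : tensor_one != 0.
Proof.
have [i hi] := coord_one_neq0 A; have [j hj] := coord_one_neq0 B.
apply/eqP=> /matrixP/(_ i j); rewrite !mxE => /eqP.
by rewrite mulf_eq0 (negPf hi) (negPf hj).
Qed.

HB.instance Definition _ := GRing.Zmodule_isNzRing.Build tensor
  tensor_mulA tensor_mul1l tensor_mul1r tensor_mulDl tensor_mulDr
  tensor_one_neq0.

Fact tensor_scaleAl (c : k) (u v : tensor) : c *: (u * v) = (c *: u) * v.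
Proof.
by have := tensor_mul_linearl v c u 0; rewrite (mul0r v : tensor_mul 0 v = 0) !addr0.
Qed.
HB.instance Definition _ :=
  GRing.Lmodule_isLalgebra.Build k tensor tensor_scaleAl.

Fact tensor_scaleAr (c : k) (u v : tensor) : c *: (u * v) = u * (c *: v).
Proof.
by have := tensor_mul_linearr u c v 0; rewrite (mulr0 u : tensor_mul u 0 = 0) !addr0.
Qed.
HB.instance Definition _ :=
  GRing.Lalgebra_isAlgebra.Build k tensor tensor_scaleAr.

HB.instance Definition _ := Algebra_isFalgebra.Build k tensor.

Lemma tensM a b a' b' : tens a b * tens a' b' = tens (a * a') (b * b').
Proof. exact: tensor_mul_tens. Qed.

Lemma tens11 : tens 1 1 = 1.
Proof. by []. Qed.

End Tensor.

Definition enveloping (k : fieldType) (A : falgType k) : falgType k :=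
  tensor A A^c.

(* A as a left module over its enveloping algebra: (a (x) b) x = a * x * b.   *)

Section RegularBimodule.
Variables (k : fieldType) (A : falgType k).

Definition regular_bimodule : Type := A.
HB.instance Definition _ := GRing.Zmodule.on regular_bimodule.

Let act (x : A) (a : A) (b : A^c) : A := a * x * (b : A).

Definition bimodule_scale (t : enveloping A) (x : regular_bimodule) :
    regular_bimodule := tensor_lift (act x) t.

Let act_bilinear x : bilinear2 (act x).
Proof.
split=> [b c y z | a c y z]; rewrite /act.
  by rewrite !mulrDl -!scalerAl.
by rewrite mulrDr -scalerAr.
Qed.

Lemma bimodule_scale_tens (a : A) (b : A^c) (x : A) :
  bimodule_scale (tens a b) x = a * x * (b : A).
Proof. exact: tensor_lift_tens. Qed.

Let scale_linearl (x : A) : linear (bimodule_scale^~ x : _ -> A).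
Proof. exact: tensor_lift_linear. Qed.

Let scale_linearr (t : enveloping A) : linear (bimodule_scale t : A -> A).
Proof.
move=> c x y; rewrite /bimodule_scale -tensor_lift_comb.
by apply: eq_tensor_lift => a b; rewrite /act mulrDr mulrDl -scalerAr -scalerAl.
Qed.

Fact bimodule_scaleA s t x :
  bimodule_scale s (bimodule_scale t x) = bimodule_scale (s * t) x.
Proof.
move: s; apply: (@tensor_ext _ _ _ A).
- exact: scale_linearl.
- exact: (linear_comp (scale_linearl x) (tensor_mul_linearl t)).
move=> a b; move: t; apply: (@tensor_ext _ _ _ A).
- exact: (linear_comp (scale_linearr _) (scale_linearl x)).
- exact: (linear_comp (scale_linearl x) (tensor_mul_linearr (tens a b))).
by move=> a' b'; rewrite tensM !bimodule_scale_tens !mulrA.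
Qed.

Fact bimodule_scale1 : left_id 1 bimodule_scale.
Proof. by move=> x; rewrite -tens11 bimodule_scale_tens mul1r mulr1. Qed.

Fact bimodule_scaleDr : right_distributive bimodule_scale +%R.
Proof. by move=> t x y; have := scale_linearr t 1 x y; rewrite !scale1r. Qed.

Fact bimodule_scaleDl x : {morph bimodule_scale^~ x : s t / s + t}.
Proof. by move=> s t; have := scale_linearl x 1 s t; rewrite !scale1r. Qed.

HB.instance Definition _ :=
  GRing.Zmodule_isLmodule.Build (enveloping A) regular_bimodule
    bimodule_scaleA bimodule_scale1 bimodule_scaleDr bimodule_scaleDl.

End RegularBimodule.

Section Homological.
Variable A : nzRingType.

Definition isomorphic (M N : lmodType A) : Prop :=
  exists f : {linear M -> N}, bijective f.

Definition projective (P : lmodType A) : Prop :=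
  forall (M N : lmodType A) (g : {linear M -> N}) (f : {linear P -> N}),
    (forall y, exists x, g x = y) ->
    exists h : {linear P -> M}, forall x, g (h x) = f x.

Record projective_resolution (M : lmodType A) := ProjectiveResolution {
  res_mod :> nat -> lmodType A;
  res_diff : forall i, {linear res_mod i.+1 -> res_mod i};
  res_aug : {linear res_mod 0 -> M};
  res_projective : forall i, projective (res_mod i);
  res_aug_surj : forall y, exists x, res_aug x = y;
  res_exact0 : forall x, res_aug x = 0 <-> exists y, res_diff 0 y = x;
  res_exactS : forall i x,
    res_diff i x = 0 <-> exists y, res_diff i.+1 y = x
}.

Definition has_resolution_of_length (M : lmodType A) (d : nat) : Prop :=
  exists P : projective_resolution M, forall i, (d < i)%N -> forall x : P i, x = 0.

Definition proj_dim (M : lmodType A) : \bar int :=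
  infimum +oo%E
    [set e | exists2 d : nat, e = (d%:Z)%:E & has_resolution_of_length M d].

(* Both bounds are taken in \bar int, where every set of naturals has an      *)
(* infimum and a supremum (a zero module has projective dimension 0 here).    *)
Definition Fin_dim : \bar int :=
  supremum -oo%E
    [set e | exists2 M : lmodType A, e = proj_dim M & (proj_dim M < +oo)%E].

(* U + K = M implies U = M; with the classical axioms of boolp, quantifying   *)
(* over boolean predicates U is quantifying over all submodules.              *)
Definition superfluous (M : lmodType A) (K : M -> Prop) : Prop :=
  forall U : {pred M}, submod_closed U ->
    (forall x, exists u v, [/\ u \in U, K v & x = u + v]) ->
    forall x, x \in U.

Definition projective_cover (P M : lmodType A) (p : {linear P -> M}) : Prop :=
  [/\ projective P, forall y, exists x, p x = y
    & superfluous (fun x => p x = 0)].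

(* "N is isomorphic to the syzygy of M": projective covers, hence syzygies,   *)
(* are only determined up to isomorphism.                                     *)
Definition is_syzygy (M N : lmodType A) : Prop :=
  exists (P : lmodType A) (p : {linear P -> M}) (i : {linear N -> P}),
    [/\ projective_cover p, injective i
      & forall x, p x = 0 <-> exists y, i y = x].

Fixpoint is_nth_syzygy (n : nat) (M N : lmodType A) : Prop :=
  if n is m.+1 then exists2 K : lmodType A, is_nth_syzygy m M K & is_syzygy K N
  else isomorphic M N.

Definition periodic (M : lmodType A) : Prop :=
  exists2 p, (0 < p)%N & is_nth_syzygy p M M.

Definition has_period (M : lmodType A) (p : nat) : Prop :=
  [/\ (0 < p)%N, is_nth_syzygy p M M
    & forall q, (0 < q)%N -> is_nth_syzygy q M M -> (p <= q)%N].

Definition eventually_periodic_module (n p : nat) (M : lmodType A) : Prop :=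
  (exists2 N : lmodType A, is_nth_syzygy n M N & has_period N p) /\
  (forall m (N : lmodType A), is_nth_syzygy m M N -> periodic N -> (n <= m)%N).

End Homological.

Definition eventually_periodic_algebra (k : fieldType) (n p : nat)
    (L : falgType k) : Prop :=
  eventually_periodic_module n p (regular_bimodule L : lmodType (enveloping L)).

(* Main.v *)
Require Import Defs.
From HB Require Import structures.
From mathcomp Require Import all_boot all_order all_algebra all_field.
From mathcomp Require Import boolp classical_sets functions constructive_ereal.

Set Implicit Arguments.
Unset Strict Implicit.
Unset Printing Implicit Defensive.

Import Order.TTheory GRing.Theory Num.Theory.
Local Open Scope ring_scope.

(** Write A for the algebra and E for its enveloping algebra; tensor products are
    over A.  Let M be an A-module of finite projective dimension, with syzygies
    M_0 = M, M_1, M_2, ..., and let N_0 = A, N_1, N_2, ... be the bimodule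
    syzygies of A, all projective as left modules.  Let P be the projective
    bimodule between N_(i+1) and N_i, and F the projective module between M_(j+1)
    and M_j.  The quotient Q of P (x) F by the image of N_(i+1) (x) M_(j+1) sits in
    two exact sequences

      0 -> N_(i+1) (x) M_j -> Q -> N_i (x) F -> 0,
      0 -> N_i (x) M_(j+1) -> Q -> P (x) M_j -> 0,

    whose right-hand ends are projective.  Hence N_(i+1) (x) M_j and
    N_i (x) M_(j+1) are both projective or both not: each is projective if and
    only if Q is.  Moving along i + j = constant:

    - if N_n has period p, then N_n (x) M is projective if and only if
      N_n (x) M_p is; after t such steps one reaches N_n (x) M_(t p), and M_(t p)
      is projective once t p is at least the projective dimension of M;
    - N_n (x) M is projective if and only if A (x) M_n = M_n is.

    So M_n is projective, that is, M has projective dimension at most n.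

    The modules N (x) M are replaced by the functors that they represent: a linear
    map from N (x) M to X is a balanced map N x M -> X, and
    [tensor_projective N M] expresses that N (x) M is projective through liftings
    of balanced maps.  A map from Q is then a balanced map on P x F that vanishes
    on N_(i+1) x M_(j+1); such maps carry the proofs of [shift_right] and
    [shift_left].

    The two ways of reading a balanced map N x M -> X, as a bimodule map
    from N to Hom_k(M, X) or as a module map from M to Hom_A(N, X), provide all
    the liftings and extensions: the former when N is a projective bimodule,
    since vector spaces are projective and injective, the latter when M is
    projective and the sequence of bimodules splits on the left.

    Everything is stated for a ring E receiving commuting ring morphisms
    lam from A and rho from the opposite of A.  The enveloping algebra of L is
    such a ring for A = L, and also for A = L^c with both sides exchanged, which
    gives the two inequalities. *)

(** * Submodules, kernels and restriction of scalars *)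

Lemma linear_map_of (R : nzRingType) (U V : lmodType R) (f : U -> V) :
  linear f -> exists F : {linear U -> V}, forall x, F x = f x.
Proof.
move=> lf; pose mf := GRing.isLinear.Build R U V *:%R f lf.
by exists (HB.pack f mf : {linear U -> V}).
Qed.

(** A single construction of modules serves for kernels and for the modules of
    linear maps: the scalars need only act correctly on the subgroup S, as
    happens on functions, where precomposition is additive in the scalar on
    linear maps alone. *)
Section SubModule.
Variables (R : nzRingType) (V : zmodType) (S : V -> Prop) (act : R -> V -> V).
Hypotheses (S0 : S 0) (SB : forall x y, S x -> S y -> S (x - y)).
Hypothesis Sact : forall r x, S x -> S (act r x).
Hypothesis actA : forall r s x, S x -> act r (act s x) = act (r * s) x.
Hypothesis act1 : forall x, S x -> act 1 x = x.
Hypothesis actDr : forall r x y, S x -> S y -> act r (x + y) = act r x + act r y.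
Hypothesis actDl : forall r s x, S x -> act (r + s) x = act r x + act s x.

Let mem : {pred V} := fun x => `[< S x >].

Let mem_closed : zmod_closed mem.
Proof.
split=> [|x y]; first exact/asboolP.
by move=> /asboolP Sx /asboolP Sy; apply/asboolP/SB.
Qed.

HB.instance Definition _ := GRing.isZmodClosed.Build V mem mem_closed.

Record sub_carrier := SubCarrier { sub_val : V; _ : sub_val \in mem }.
HB.instance Definition _ := [isSub for sub_val].
HB.instance Definition _ := [Choice of sub_carrier by <:].
HB.instance Definition _ := [SubChoice_isSubZmodule of sub_carrier by <:].

Let sub_valP (u : sub_carrier) : S (val u).
Proof. by apply/asboolP; case: u. Qed.

Let in_mem x : S x -> x \in mem.
Proof. by move=> Sx; apply/asboolP. Qed.

Let scale (r : R) (u : sub_carrier) : sub_carrier :=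
  SubCarrier (in_mem (Sact r (sub_valP u))).

Let scaleA r s u : scale r (scale s u) = scale (r * s) u.
Proof. by apply: val_inj; rewrite /= actA //; apply: sub_valP. Qed.
Let scale1 : left_id 1 scale.
Proof. by move=> u; apply: val_inj; rewrite /= act1 //; apply: sub_valP. Qed.
Let scaleDr : right_distributive scale +%R.
Proof. by move=> r u v; apply: val_inj; rewrite /= actDr //; apply: sub_valP. Qed.
Let scaleDl u : {morph scale^~ u : r s / r + s}.
Proof. by move=> r s; apply: val_inj; rewrite /= actDl //; apply: sub_valP. Qed.

HB.instance Definition _ :=
  GRing.Zmodule_isLmodule.Build R sub_carrier scaleA scale1 scaleDr scaleDl.

Lemma sub_module : exists (U : lmodType R) (ev : U -> V),
  [/\ injective ev, forall u, S (ev u), forall v, S v -> exists u, ev u = v,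
      {morph ev : x y / x + y} & forall r u, ev (r *: u) = act r (ev u)].
Proof.
exists (sub_carrier : lmodType R), (val : sub_carrier -> V); split=> //.
by move=> v Sv; exists (SubCarrier (in_mem Sv)).
Qed.

End SubModule.

Lemma kernel_exists (R : nzRingType) (F M : lmodType R) (p : {linear F -> M}) :
  exists (K : lmodType R) (i : {linear K -> F}),
    injective i /\ forall x, p x = 0 <-> exists y, i y = x.
Proof.
have [|||||||K [ev [evI evS evE evD evZ]]] :=
  @sub_module R F (fun x => p x = 0) *:%R.
- exact: linear0.
- by move=> x y px py; rewrite linearB px py subr0.
- by move=> r x px; rewrite linearZ_LR px scaler0.
- by move=> r s x _; rewrite scalerA.
- by move=> x _; rewrite scale1r.
- by move=> r x y _ _; rewrite scalerDr.
- by move=> r s x _; rewrite scalerDl.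
have [i iE] := @linear_map_of R K F ev (fun a x y => etrans (evD _ _) (congr1 (+%R^~ _) (evZ _ _))).
exists K, i; split=> [x y|x]; first by rewrite !iE; apply: evI.
by split=> [/evE[y <-]|[y <-]]; [exists y; rewrite iE | rewrite iE; apply: evS].
Qed.

Definition scalar_restr (R S : nzRingType) (h : {rmorphism R -> S})
  (M : lmodType S) : Type := M.

Section Restriction.
Variables (R S : nzRingType) (h : {rmorphism R -> S}) (M : lmodType S).
Local Notation scalar_restr := (scalar_restr h M).

HB.instance Definition _ := GRing.Zmodule.on scalar_restr.

Let scale (r : R) (x : scalar_restr) : scalar_restr := h r *: (x : M).

Let scaleA r s x : scale r (scale s x) = scale (r * s) x.
Proof. by rewrite /scale scalerA rmorphM. Qed.
Let scale1 : left_id 1 scale.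
Proof. by move=> x; rewrite /scale rmorph1 scale1r. Qed.
Let scaleDr : right_distributive scale +%R.
Proof. by move=> r x y; rewrite /scale scalerDr. Qed.
Let scaleDl x : {morph scale^~ x : r s / r + s}.
Proof. by move=> r s; rewrite /scale rmorphD scalerDl. Qed.

HB.instance Definition _ :=
  GRing.Zmodule_isLmodule.Build R scalar_restr scaleA scale1 scaleDr scaleDl.

Lemma scalar_restrE (r : R) (x : scalar_restr) : r *: x = h r *: (x : M).
Proof. by []. Qed.
End Restriction.

Definition over_k (k : fieldType) (A : algType k) (M : lmodType A) :
  lmodType k := @scalar_restr k A (in_alg A) M.

(** * Vector spaces are projective and injective *)

Section VectorSpaces.
Variable k : fieldType.

(** By Zorn's lemma the image of i has a complement, a subspace C maximal among
    those meeting the image trivially; r is the projection along C. *)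
Lemma linear_retraction (U V : lmodType k) (i : {linear U -> V}) :
  injective i -> exists r : {linear V -> U}, cancel i r.
Proof.
move=> iI.
(* The empty union must satisfy P, so P does not ask for 0. *)
pose P (C : set V) := (forall c x y, C x -> C y -> C (c *: x + y)) /\
  (forall u, C (i u) -> u = 0).
have [|C [[CL CI] Cmax]] := @Zorn_bigcup V P.
  move=> F FP Ftot; split=> [c x y [X FX Xx] [Y FY Yy]|u [X FX]]; last first.
    by have [_] := FP _ FX; apply.
  have [XY|YX] := Ftot _ _ FX FY.
    by exists Y => //; have [L _] := FP _ FY; apply: L => //; apply: XY.
  by exists X => //; have [L _] := FP _ FX; apply: L => //; apply: YX.
have C0 : C 0.
  have [[x Cx]|C0] := pselect (exists x, C x).
    by have := CL (-1) x x Cx Cx; rewrite scaleN1r addNr.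
  case: (Cmax [set 0]%classic).
    split=> [x Cx|/(_ 0 erefl)]; [by case: C0; exists x | by move=> ?; case: C0; exists 0].
  split=> [c x y -> ->|u /= /eqP]; first by rewrite scaler0 addr0.
  by rewrite -(linear0 i) => /eqP /iI.
have Csum v : exists u x, C x /\ v = i u + x.
  apply: contrapT => nv; apply: (Cmax [set v' | exists c x, C x /\ v' = c *: v + x]%classic).
    split=> [x Cx|]; first by exists 0, x; rewrite scale0r add0r.
    move=> /(_ v) H; apply: nv; exists 0, v; rewrite linear0 add0r; split=> //.
    by apply: H; exists 1, 0; rewrite scale1r addr0.
  split=> [c _ _ [c1 [x1 [C1 ->]]] [c2 [x2 [C2 ->]]]|u [c [x [Cx e]]]].
    exists (c * c1 + c2), (c *: x1 + x2); split; first exact: CL.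
    by rewrite scalerDr scalerA scalerDl addrACA.
  have [c0|c0] := eqVneq c 0.
    by move: e; rewrite c0 scale0r add0r => e; apply: CI; rewrite e.
  case: nv; exists (c^-1 *: u), (- c^-1 *: x); split.
    by have := CL (- c^-1) x 0 Cx C0; rewrite addr0.
  by rewrite linearZ_LR e scalerDr scalerA mulVf // scale1r scaleNr addrK.
have uniq u x u' x' : C x -> C x' -> i u + x = i u' + x' -> u = u'.
  move=> Cx Cx' e; apply/eqP; rewrite -subr_eq0; apply/eqP/CI.
  have -> : i (u - u') = (-1) *: x + x'.
    apply/eqP; rewrite linearB subr_eq scaleN1r -addrA [x' + _]addrC -e.
    by rewrite addrC addrK.
  exact: CL.
have /choice[r rP] : forall v, exists u, exists2 x, C x & v = i u + x.
  by move=> v; have [u [x [Cx e]]] := Csum v; exists u, x.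
have [|F FE] := @linear_map_of k V U r.
  move=> c v w; have [x Cx ex] := rP v; have [y Cy ey] := rP w.
  have [z Cz ez] := rP (c *: v + w).
  apply: (uniq _ z _ (c *: x + y)) => //; first exact: CL.
  by rewrite -ez {1}ex {1}ey linearP scalerDr addrACA.
exists F => u; rewrite FE; have [x Cx ex] := rP (i u).
by apply: (uniq _ x _ 0) => //; rewrite addr0.
Qed.

(** A retraction r onto the kernel of g makes v - r v depend only on g v. *)
Lemma linear_section (V W : lmodType k) (g : {linear V -> W}) :
  (forall y, exists x, g x = y) -> exists s : {linear W -> V}, cancel s g.
Proof.
move=> /choice[t tK]; have [K [i [iI iE]]] := kernel_exists g.
have [r rK] := linear_retraction iI.
pose q v := v - i (r v).
have qL : linear q.
  move=> c v w; rewrite /q (linearP r) (linearP i) opprD scalerBr.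
  by rewrite addrACA.
have qg v w : g v = g w -> q v = q w.
  move=> e; have /iE[y ey] : g (v - w) = 0 by rewrite linearB e subrr.
  have -> : v = i y + w by rewrite ey subrK.
  by rewrite -[i y]scale1r qL /q rK subrr scaler0 add0r.
have gq v : g (q v) = g v.
  by rewrite linearB (_ : g (i _) = 0) ?subr0 //; apply/iE; exists (r v).
have [|s sE] := @linear_map_of k W V (fun w => q (t w)).
  by move=> c v w; rewrite -qL; apply: qg; rewrite linearP !tK.
by exists s => w; rewrite sE gq tK.
Qed.

End VectorSpaces.

(** * Resolutions and projective dimension *)

Section Resolutions.
Variable R : nzRingType.
Implicit Types K F M N : lmodType R.

Definition short_exact K F M (i : {linear K -> F}) (p : {linear F -> M}) :=
  [/\ injective i, forall y, exists x, p x = y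
    & forall x, p x = 0 <-> exists y, i y = x].

Lemma projective_iso M N (f : {linear M -> N}) :
  bijective f -> projective M -> projective N.
Proof.
move=> [f' fK f'K] prM X Y g h gS.
have [l lE] := prM X Y g (h \o f) gS.
have [|F FE] := @linear_map_of R N X (l \o f').
  move=> c x y; rewrite /= -linearP; congr (l _); apply: (can_inj fK).
  by rewrite linearP !f'K.
by exists F => x; rewrite FE lE /= f'K.
Qed.

Lemma projective_zero M : (forall x : M, x = 0) -> projective M.
Proof.
move=> M0 X Y g h _; have [|F FE] := @linear_map_of R M X (fun=> 0).
  by move=> c x y; rewrite scaler0 addr0.
by exists F => x; rewrite FE (M0 x) !linear0.
Qed.

Lemma regular_projective : projective (R^o : lmodType R).
Proof.
move=> X Y g h gS; have [x0 gx0] := gS (h 1).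
have [|F FE] := @linear_map_of R R^o X (fun a : R => a *: x0).
  by move=> c a b; rewrite scalerDl scalerA.
by exists F => a; rewrite FE linearZ_LR gx0 -(linearZ_LR h) [_ *: _]mulr1.
Qed.

Lemma resolution_projective M :
  has_resolution_of_length M 0 -> projective M.
Proof.
case=> r r0; apply: (@projective_iso _ _ (res_aug r)); last exact: res_projective.
have inj : injective (res_aug r).
  move=> x y e; apply/eqP; rewrite -subr_eq0; apply/eqP.
  have /res_exact0[z <-] : res_aug r (x - y) = 0 by rewrite linearB e subrr.
  by rewrite (r0 1%N isT z) linear0.
have /choice[f fK] := @res_aug_surj _ _ r.
by exists f => // x; apply: inj; rewrite fK.
Qed.

Lemma resolution_tail M d : has_resolution_of_length M d ->
  exists (K F : lmodType R) (i : {linear K -> F}) (p : {linear F -> M}),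
    [/\ projective F, short_exact i p & has_resolution_of_length K d.-1].
Proof.
case=> r r0; have [K [i [iI iE]]] := kernel_exists (res_aug r).
exists K, (r 0), i, (res_aug r).
split; [exact: res_projective | by split=> //; apply: res_aug_surj |].
have /choice[a aE] : forall x, exists y, i y = res_diff r 0 x.
  by move=> x; apply/iE/res_exact0; exists x.
have [|aug augE] := @linear_map_of R (r 1) K a.
  by move=> c x y; apply: iI; rewrite linearP !aE linearP.
have aug_surj y : exists x, aug x = y.
  have /res_exact0[x xE] : res_aug r (i y) = 0 by apply/iE; exists y.
  by exists x; apply: iI; rewrite augE aE.
have exact0 x : aug x = 0 <-> exists y, res_diff r 1 y = x.
  rewrite augE -res_exactS -aE; split=> [->|/eqP]; first exact: linear0.
  by rewrite -(linear0 i) => /eqP/iI.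
exists (@ProjectiveResolution R K (fun j => r j.+1) (fun j => res_diff r j.+1)
  aug (fun j => @res_projective _ _ r j.+1) aug_surj exact0
  (fun j => @res_exactS _ _ r j.+1)).
by move=> j dj; apply: r0; move: dj; case: (d).
Qed.

Lemma resolution_cons K F M (i : {linear K -> F}) (p : {linear F -> M}) d :
  projective F -> short_exact i p -> has_resolution_of_length K d ->
  has_resolution_of_length M d.+1.
Proof.
move=> prF [iI pS pE] [r r0].
pose md j : lmodType R := if j is j'.+1 then r j' else F.
pose df j : {linear md j.+1 -> md j} :=
  match j return {linear md j.+1 -> md j} with
  | 0 => (i \o res_aug r : {linear _ -> _})
  | j'.+1 => res_diff r j'
  end.
have prm j : projective (md j) by case: j => // j; apply: res_projective.
have ex0 x : p x = 0 <-> exists y, df 0 y = x.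
  rewrite pE; split=> -[y <-]; last by exists (res_aug r y).
  by have [z <-] := res_aug_surj r y; exists z.
have exS j x : df j x = 0 <-> exists y, df j.+1 y = x.
  case: j x => [|j] x; last exact: res_exactS.
  rewrite /= -res_exact0; split=> [/eqP|->]; last exact: linear0.
  by rewrite -(linear0 i) => /eqP/iI.
exists (@ProjectiveResolution R M md df p prm pS ex0 exS).
by case=> // j dj; apply: r0.
Qed.

Lemma projective_resolution0 M :
  projective M -> has_resolution_of_length M 0.
Proof.
move=> prM; pose Z : lmodType R := 'M[R]_(0, 0).
have Z0 (x : Z) : x = 0 by apply/matrixP; case.
pose md j : lmodType R := if j is 0 then M else Z.
have zero_map (U V : lmodType R) : exists F : {linear U -> V}, forall x, F x = 0.
  by apply: linear_map_of => c x y; rewrite scaler0 addr0.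
pose df j : {linear md j.+1 -> md j} := projT1 (cid (zero_map _ _)).
have dfE j x : df j x = 0 by apply: projT2 (cid (zero_map _ _)) x.
have [idM idE] : exists F : {linear M -> M}, forall x, F x = x.
  by apply: linear_map_of.
have prm j : projective (md j).
  by case: j => // j; apply: projective_zero; apply: Z0.
have surj y : exists x, idM x = y by exists y.
have ex0 (x : M) : idM x = 0 <-> exists y, df 0 y = x :> M.
  rewrite idE; split=> [->|[y <-]]; last exact: (dfE 0).
  by exists 0; apply: (dfE 0).
have exS j x : df j x = 0 <-> exists y, df j.+1 y = x.
  split=> [_|[y <-]]; last by rewrite !dfE.
  by exists 0; rewrite dfE (Z0 x).
exists (@ProjectiveResolution R M md df idM prm surj ex0 exS).
by case=> // j _ x; apply: Z0.
Qed.

(** Unlike [is_nth_syzygy], this asks for projective presentations that need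
    not be minimal, and peels off the step next to M rather than the last one,
    so that a module syzygy and a bimodule syzygy can be matched step by step in
    opposite orders. *)
Fixpoint chain_syzygy (m : nat) M N : Prop :=
  if m is m'.+1 then
    exists (K F : lmodType R) (i : {linear K -> F}) (p : {linear F -> M}),
      [/\ projective F, short_exact i p & chain_syzygy m' K N]
  else M = N.

Lemma chain_syzygy_exists m M d : has_resolution_of_length M d ->
  exists2 N, chain_syzygy m M N & has_resolution_of_length N (d - m).
Proof.
elim: m M d => [|m IH] M d resM; first by exists M; rewrite ?subn0.
have [K [F [i [p [prF ex resK]]]]] := resolution_tail resM.
have [N KN resN] := IH _ _ resK.
exists N; first by exists K, F, i, p.
by move: resN; rewrite -subn1 -subnDA add1n.
Qed.

Lemma chain_syzygy_resolution m M N d : chain_syzygy m M N ->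
  has_resolution_of_length N d -> has_resolution_of_length M (m + d).
Proof.
elim: m M => [|m IH] M /=; first by move=> <-.
move=> [K [F [i [p [prF ex KN]]]]] resN; rewrite addSn.
exact: resolution_cons prF ex (IH _ KN resN).
Qed.

Lemma proj_dim_finite M :
  (proj_dim M < +oo)%E -> exists d, has_resolution_of_length M d.
Proof.
rewrite /proj_dim /infimum; case: eqP => [_|/eqP/set0P[e [d _ resM]] _].
  by rewrite ltxx.
by exists d.
Qed.

(** The infimum is attained at the least length of a resolution. *)
Lemma proj_dim_le M n :
  has_resolution_of_length M n -> (proj_dim M <= (n%:Z)%:E)%E.
Proof.
move=> resM; rewrite /proj_dim /infimum; set D := (X in X == set0).
have Dn : D (n%:Z)%:E by exists n.
case: eqP => [D0|_]; first by move: Dn; rewrite D0.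
pose P d := `[< has_resolution_of_length M d >].
have exP : exists d, P d by exists n; apply/asboolP.
case: (ex_minnP exP) => d /asboolP resd dmin.
case: xgetP => [y _ [lb _]|none]; first exact: lb.
case: (none (d%:Z)%:E); split=> [e [d' -> resd']|e]; last by apply; exists d.
by rewrite lee_fin lez_nat; apply: dmin; apply/asboolP.
Qed.

Lemma Fin_dim_le n :
  (forall M d, has_resolution_of_length M d -> has_resolution_of_length M n) ->
  (Fin_dim R <= (n%:Z)%:E)%E.
Proof.
move=> H; rewrite /Fin_dim /supremum; case: eqP => [_|_]; first exact: leNye.
case: xgetP => [y _ [_ lub]|_]; last exact: leNye.
apply: lub => e [M -> /proj_dim_finite[d /H]]; exact: proj_dim_le.
Qed.

End Resolutions.

(** * Balanced maps *)

Section Bimodules.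
Variables (k : fieldType) (A : algType k) (E : nzRingType).
Variables (lam : {rmorphism A -> E}) (rho : {rmorphism A^c -> E}).

Local Notation left_mod N := (scalar_restr lam N : lmodType A).

(** Balanced maps are the A-linear maps out of the tensor product of N and M
    over A, where N is a bimodule through lam and rho. *)
Definition balanced (N : lmodType E) (M X : lmodType A) (b : N -> M -> X) :=
  [/\ forall m, {morph b^~ m : x y / x + y}, forall n, {morph b n : x y / x + y},
      forall a n m, b (lam a *: n) m = a *: b n m
    & forall (a : A) n m, b (rho a *: n) m = b n (a *: m)].

(** Projectivity of the A-module N (x) M, the tensor product over A. *)
Definition tensor_projective (N : lmodType E) (M : lmodType A) :=
  forall (X Y : lmodType A) (g : {linear X -> Y}) (b : N -> M -> Y),
    (forall y, exists x, g x = y) -> balanced b ->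
    exists2 c : N -> M -> X, balanced c & forall n m, g (c n m) = b n m.

(** What is used of the tensor product of A and A^c: it is generated by the
    images of A and A^c, which commute and agree on k, and a pair of
    commuting k-linear actions extends to it; the last fact is needed for
    Hom_k(M, X) only. *)
Record enveloping_ring : Prop := EnvelopingRing {
  env_comm : forall a b, lam a * rho b = rho b * lam a;
  env_central : forall c : k, lam (c%:A) = rho (c%:A);
  env_linear : forall (N N' : lmodType E) (f : N -> N'),
    {morph f : x y / x + y} -> (forall a x, f (lam a *: x) = lam a *: f x) ->
    (forall a x, f (rho a *: x) = rho a *: f x) -> linear f;
  env_hom : forall M X : lmodType A,
    exists (U : lmodType E) (ev : U -> M -> X),
      [/\ balanced ev, forall u v, ev u =1 ev v -> u = v
        & forall f : {linear over_k M -> over_k X}, exists u, ev u =1 f] }.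

Section BalancedOps.
Variables (N : lmodType E) (M X : lmodType A).

Lemma balanced_comp (Y : lmodType A) (g : {linear X -> Y}) (b : N -> M -> X) :
  balanced b -> balanced (fun n m => g (b n m)).
Proof.
case=> bl br ba bb; split=> [m x y|n x y|a n m|a n m].
- by rewrite bl linearD.
- by rewrite br linearD.
- by rewrite ba linearZ_LR.
- by rewrite bb.
Qed.

Lemma balanced_mapl (N' : lmodType E) (i : {linear N' -> N}) (b : N -> M -> X) :
  balanced b -> balanced (fun n m => b (i n) m).
Proof.
case=> bl br ba bb; split=> [m x y|n x y|a n m|a n m].
- by rewrite linearD bl.
- by rewrite br.
- by rewrite linearZ_LR ba.
- by rewrite linearZ_LR bb.
Qed.

Lemma balanced_mapr (M' : lmodType A) (j : {linear M' -> M}) (b : N -> M -> X) :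
  balanced b -> balanced (fun n m => b n (j m)).
Proof.
case=> bl br ba bb; split=> [m x y|n x y|a n m|a n m].
- by rewrite bl.
- by rewrite linearD br.
- by rewrite ba.
- by rewrite bb linearZ_LR.
Qed.

Lemma balanced_sub (b c : N -> M -> X) :
  balanced b -> balanced c -> balanced (fun n m => b n m - c n m).
Proof.
case=> bl br ba bb [cl cr ca cb]; split=> [m x y|n x y|a n m|a n m].
- by rewrite bl cl opprD addrACA.
- by rewrite br cr opprD addrACA.
- by rewrite ba ca scalerBr.
- by rewrite bb cb.
Qed.

Lemma balanced_linearl (b : N -> M -> X) m :
  balanced b -> linear (b^~ m : left_mod N -> X).
Proof. by case=> bl _ ba _ a x y; rewrite bl scalar_restrE ba. Qed.

Lemma balanced_linearr (b : N -> M -> X) n :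
  (forall c : k, lam (c%:A) = rho (c%:A)) ->
  balanced b -> linear (b n : over_k M -> over_k X).
Proof.
move=> central [_ br ba bb] c x y.
by rewrite br !scalar_restrE -bb -ba /= central.
Qed.

Lemma balancedBl (b : N -> M -> X) m x y :
  balanced b -> b (x - y) m = b x m - b y m.
Proof.
by case=> bl _ _ _; apply/eqP; rewrite -(inj_eq (addIr (b y m))) -bl !subrK.
Qed.

Lemma balancedBr (b : N -> M -> X) n x y :
  balanced b -> b n (x - y) = b n x - b n y.
Proof.
by case=> _ br _ _; apply/eqP; rewrite -(inj_eq (addIr (b n y))) -br !subrK.
Qed.

Lemma balanced0l (b : N -> M -> X) m : balanced b -> b 0 m = 0.
Proof. by move=> bb; rewrite -(subrr 0) balancedBl // subrr. Qed.

Lemma balanced0r (b : N -> M -> X) n : balanced b -> b n 0 = 0.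
Proof. by move=> bb; rewrite -(subrr 0) balancedBr // subrr. Qed.

End BalancedOps.

Lemma balanced_factorl (K P N : lmodType E) (i : {linear K -> P})
    (p : {linear P -> N}) (M X : lmodType A) (b : P -> M -> X) :
  short_exact i p -> balanced b -> (forall x m, b (i x) m = 0) ->
  exists2 c : N -> M -> X, balanced c & forall x m, c (p x) m = b x m.
Proof.
move=> [_ /choice[s sK] pE] bb b0.
have bs x m : b (s (p x)) m = b x m.
  apply/eqP; rewrite -subr_eq0 -balancedBl //.
  by have /pE[y <-] : p (s (p x) - x) = 0; rewrite ?b0 // linearB sK subrr.
exists (fun n m => b (s n) m) => //.
have [bl br ba bc] := bb; split=> [m x y|n x y|a n m|a n m].
- by rewrite -bl -[RHS]bs linearD !sK.
- by rewrite br.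
- by rewrite -ba -[RHS]bs linearZ_LR sK.
- by rewrite -bc -[RHS]bs linearZ_LR sK.
Qed.

Lemma balanced_factorr (M' F M : lmodType A) (j : {linear M' -> F})
    (q : {linear F -> M}) (N : lmodType E) (X : lmodType A) (b : N -> F -> X) :
  short_exact j q -> balanced b -> (forall n x, b n (j x) = 0) ->
  exists2 c : N -> M -> X, balanced c & forall n x, c n (q x) = b n x.
Proof.
move=> [_ /choice[s sK] qE] bb b0.
have bs n x : b n (s (q x)) = b n x.
  apply/eqP; rewrite -subr_eq0 -balancedBr //.
  by have /qE[y <-] : q (s (q x) - x) = 0; rewrite ?b0 // linearB sK subrr.
exists (fun n m => b n (s m)) => //.
have [bl br ba bc] := bb; split=> [m x y|n x y|a n m|a n m].
- by rewrite bl.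
- by rewrite -br -[RHS]bs linearD !sK.
- by rewrite ba.
- by rewrite bc -[LHS]bs linearZ_LR sK.
Qed.

Hypothesis env : enveloping_ring.

(** * The two adjunctions *)

(** Every balanced map factors through the universal one, ev : U x M -> X, where
    U is Hom_k(M, X). *)
Lemma curry_bimodule (N : lmodType E) (M X : lmodType A) (U : lmodType E)
    (ev : U -> M -> X) :
  balanced ev -> (forall u v, ev u =1 ev v -> u = v) ->
  (forall f : {linear over_k M -> over_k X}, exists u, ev u =1 f) ->
  forall b : N -> M -> X, balanced b ->
  exists f : {linear N -> U}, forall n m, ev (f n) m = b n m.
Proof.
move=> [el er ea eb] evI evS b bb; have [bl br ba bc] := bb.
have /choice[f fE] : forall n, exists u, ev u =1 b n.
  move=> n; have [h hE] := linear_map_of (balanced_linearr n (env_central env) bb).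
  by have [u uE] := evS h; exists u => m; rewrite uE hE.
have [|F FE] := @linear_map_of E N U f; last first.
  by exists F => n m; rewrite FE fE.
apply: (env_linear env) => [x y|a x|a x]; apply: evI => m.
- by rewrite el !fE bl.
- by rewrite ea !fE ba.
- by rewrite eb !fE bc.
Qed.

(** Hom_k(M, -) is exact because vector spaces are projective, so a bimodule map
    from P to Hom_k(M, Y) lifts to Hom_k(M, X). *)
Lemma projective_lift_balanced (P : lmodType E) (M : lmodType A) :
  projective P -> tensor_projective P M.
Proof.
move=> prP X Y g b gS bb.
have [U [ev [evB evI evS]]] := env_hom env M X.
have [V [fv [fvB fvI fvS]]] := env_hom env M Y.
have [G GE] := curry_bimodule fvB fvI fvS (balanced_comp g evB).
have [f fE] := curry_bimodule fvB fvI fvS bb.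
have [|gk gkE] := @linear_map_of k (over_k X) (over_k Y) g.
  by move=> c x y; rewrite !scalar_restrE linearP.
have [|s sK] := @linear_section k _ _ gk.
  by move=> y; have [x gx] := gS y; exists x; rewrite gkE.
have GS v : exists u, G u = v.
  have [h hE] := linear_map_of (balanced_linearr v (env_central env) fvB).
  have [u uE] := evS (s \o h); exists u; apply: fvI => m.
  by rewrite GE uE -gkE /= sK hE.
have [h hE] := prP U V G f GS.
exists (fun n m => ev (h n) m); first exact: balanced_mapl.
by move=> n m; rewrite -GE hE fE.
Qed.

(** Hom_k(F, X) maps onto Hom_k(M, X) because vector spaces are injective. *)
Lemma projective_extend_balanced (P : lmodType E) (M F X : lmodType A)
    (j : {linear M -> F}) (b : P -> M -> X) :
  projective P -> injective j -> balanced b ->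
  exists2 c : P -> F -> X, balanced c & forall n m, c n (j m) = b n m.
Proof.
move=> prP jI bb.
have [U [ev [evB evI evS]]] := env_hom env F X.
have [V [fv [fvB fvI fvS]]] := env_hom env M X.
have [G GE] := curry_bimodule fvB fvI fvS (balanced_mapr j evB).
have [f fE] := curry_bimodule fvB fvI fvS bb.
have [|jk jkE] := @linear_map_of k (over_k M) (over_k F) j.
  by move=> c x y; rewrite !scalar_restrE linearP.
have [|r rK] := @linear_retraction k _ _ jk.
  by move=> x y; rewrite !jkE; apply: jI.
have GS v : exists u, G u = v.
  have [h hE] := linear_map_of (balanced_linearr v (env_central env) fvB).
  have [u uE] := evS (h \o r); exists u; apply: fvI => m.
  by rewrite GE uE -jkE /= rK hE.
have [h hE] := prP U V G f GS.
exists (fun n m => ev (h n) m); first exact: balanced_mapl.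
by move=> n m; rewrite -GE hE fE.
Qed.

(** V is Hom_A(N, X), the left linear maps, on which A acts through the right
    structure of N. *)
Lemma left_hom (N : lmodType E) (X : lmodType A) :
  exists (V : lmodType A) (ev : N -> V -> X),
    [/\ balanced ev, forall u v, ev^~ u =1 ev^~ v -> u = v
      & forall f : {linear left_mod N -> X}, exists v, ev^~ v =1 f].
Proof.
pose S (f : N -> X) := linear (f : left_mod N -> X).
pose act (a : A) (f : N -> X) : N -> X := fun n => f (rho a *: n).
have SD (f : N -> X) x y : S f -> f (x + y) = f x + f y.
  by move=> Sf; have := Sf 1 x y; rewrite !scale1r.
have SZ (f : N -> X) a x : S f -> f (lam a *: x) = a *: f x.
  move=> Sf; have f0 : f 0 = 0.
    by apply: (@addIr _ (f 0)); rewrite -SD // !add0r.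
  by have := Sf a x 0; rewrite f0 !addr0.
have [|||||||V [ev [evI evS evE evD evZ]]] := @sub_module A (N -> X) S act.
- by move=> a x y; rewrite scaler0 addr0.
- move=> f g Sf Sg a x y; have subE z : (f - g) z = f z - g z by [].
  by rewrite !subE Sf Sg scalerBr opprD addrACA.
- move=> a f Sf c x y; rewrite /act !scalar_restrE scalerDr SD // scalerA.
  by rewrite -(env_comm env) -scalerA SZ.
- move=> a b f _; rewrite /act; apply: funext => n.
  by rewrite scalerA -rmorphM.
- by move=> f _; rewrite /act; apply: funext => n; rewrite rmorph1 scale1r.
- by [].
- move=> a b f Sf; rewrite /act; apply: funext => n /=.
  by rewrite rmorphD scalerDl SD.
exists V, (fun n v => ev v n); split.
- split=> [v x y|n u v|a n v|a n v].
  + exact: SD.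
  + by rewrite evD.
  + exact: SZ.
  + by rewrite evZ.
- by move=> u v uv; apply: evI; apply: funext.
- move=> f; have [v vE] : exists v, ev v = f by apply: evE => a x y; apply: linearP.
  by exists v => n; rewrite vE.
Qed.

Lemma curry_left (N : lmodType E) (M X V : lmodType A) (ev : N -> V -> X) :
  balanced ev -> (forall u v, ev^~ u =1 ev^~ v -> u = v) ->
  (forall f : {linear left_mod N -> X}, exists v, ev^~ v =1 f) ->
  forall b : N -> M -> X, balanced b ->
  exists f : {linear M -> V}, forall n m, ev n (f m) = b n m.
Proof.
move=> [el er ea eb] evI evS b bb; have [bl br ba bc] := bb.
have /choice[f fE] : forall m, exists v, ev^~ v =1 b^~ m.
  move=> m; have [h hE] := linear_map_of (balanced_linearl m bb).
  by have [u uE] := evS h; exists u => n; rewrite uE hE.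
have [|F FE] := @linear_map_of A M V f; last first.
  by exists F => n m; rewrite FE fE.
move=> a x y; apply: evI => n.
by rewrite er -eb !fE br bc.
Qed.

(** Hom_A(N, -) is exact, so a module map from F to Hom_A(N, Y) lifts to
    Hom_A(N, X). *)
Lemma tensor_projective_left (N : lmodType E) (F : lmodType A) :
  projective (left_mod N) -> projective F -> tensor_projective N F.
Proof.
move=> prN prF X Y g b gS bb.
have [U [ev [evB evI evS]]] := left_hom N X.
have [V [fv [fvB fvI fvS]]] := left_hom N Y.
have [G GE] := curry_left fvB fvI fvS (balanced_comp g evB).
have [f fE] := curry_left fvB fvI fvS bb.
have GS v : exists u, G u = v.
  have [h hE] := linear_map_of (balanced_linearl v fvB).
  have [h' h'E] := prN X Y g h gS.
  have [u uE] := evS h'; exists u; apply: fvI => n.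
  by rewrite GE uE h'E hE.
have [h hE] := prF U V G f GS.
exists (fun n m => ev n (h m)); first exact: balanced_mapr.
by move=> n m; rewrite -GE hE fE.
Qed.

(** The case M = A of [projective_lift_balanced], since P (x) A = P. *)
Lemma projective_left (P : lmodType E) : projective P -> projective (left_mod P).
Proof.
move=> prP X Y g f gS.
have [|c [cl cr ca cb] cE] :=
  @projective_lift_balanced P A^o prP X Y g (fun n a => f (rho a *: n)) gS.
  split=> [a x y|n a a'|a n a'|a n a'].
  - by rewrite scalerDr linearD.
  - by rewrite rmorphD scalerDl linearD.
  - by rewrite -linearZ_LR scalar_restrE !scalerA (env_comm env).
  - by rewrite scalerA -rmorphM.
have [|F FE] := @linear_map_of A (left_mod P) X (c^~ 1).
  by move=> a x y; rewrite cl scalar_restrE ca.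
by exists F => x; rewrite FE cE rmorph1 scale1r.
Qed.

Section Split.
Variables (K P N : lmodType E) (i : {linear K -> P}) (p : {linear P -> N}).
Hypotheses (ex : short_exact i p) (prN : projective (left_mod N)).

Lemma left_retraction : exists r : {linear left_mod P -> left_mod K}, cancel i r.
Proof.
have [iI pS pE] := ex.
have [|p' p'E] := @linear_map_of A (left_mod P) (left_mod N) p.
  by move=> a x y; rewrite !scalar_restrE linearP.
have [idN idNE] : exists f : {linear left_mod N -> left_mod N}, forall x, f x = x.
  exact: linear_map_of.
have [|s sE] := prN (g := p') idN.
  by move=> y; have [x xE] := pS y; exists x; rewrite p'E.
have sK x : p (s x) = x by rewrite -p'E sE idNE.
have /choice[r rE] : forall x : P, exists y, i y = x - s (p x).
  by move=> x; apply/pE; rewrite linearB sK subrr.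
have [|r' r'E] := @linear_map_of A (left_mod P) (left_mod K) r.
  move=> a x y; apply: iI; rewrite rE !scalar_restrE (linearP i) !rE (linearP p).
  by rewrite -scalar_restrE (linearP s) scalerBr opprD addrACA.
exists r' => x; apply: iI; rewrite r'E rE.
have -> : p (i x) = 0 by apply/pE; exists x.
by rewrite (linear0 s) subr0.
Qed.

Lemma projective_left_kernel : projective (left_mod P) -> projective (left_mod K).
Proof.
move=> prP X Y g f gS; have [r rK] := left_retraction.
have [h hE] := prP X Y g (f \o r) gS.
have [|F FE] := @linear_map_of A (left_mod K) X (h \o i).
  by move=> a x y; rewrite /= scalar_restrE linearP -scalar_restrE (linearP h).
by exists F => x; rewrite FE hE /= rK.
Qed.

Lemma extend_balanced_left (F X : lmodType A) (b : K -> F -> X) :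
  projective F -> balanced b ->
  exists2 c : P -> F -> X, balanced c & forall n m, c (i n) m = b n m.
Proof.
move=> prF bb; have [r rK] := left_retraction.
have [U [ev [evB evI evS]]] := left_hom P X.
have [V [fv [fvB fvI fvS]]] := left_hom K X.
have [G GE] := curry_left fvB fvI fvS (balanced_mapl i evB).
have [f fE] := curry_left fvB fvI fvS bb.
have GS v : exists u, G u = v.
  have [h hE] := linear_map_of (balanced_linearl v fvB).
  have [u uE] := evS (h \o r); exists u; apply: fvI => n.
  by rewrite GE uE /= rK hE.
have [h hE] := prF U V G f GS.
exists (fun n m => ev n (h m)); first exact: balanced_mapr.
by move=> n m; rewrite -GE hE fE.
Qed.

End Split.

(** * Dimension shifting *)

(** Let c be a balanced map on P x F that vanishes on K x M'.  Its restriction to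
    K x F descends to K x M, and its restriction to P x M' descends to N x M'.
    Each lemma builds such a c from the map to be lifted, lifts the other
    restriction by hypothesis, and extends that lift to a map h on P x F.  The
    difference between c and g o h then descends to N x F or to P x M, where
    maps are known to lift.  Correcting h by a lift of that difference
    gives a lift of c, hence of the given map. *)
Section Shift.
Variables (K P N : lmodType E) (i : {linear K -> P}) (p : {linear P -> N}).
Variables (M' F M : lmodType A) (j : {linear M' -> F}) (q : {linear F -> M}).
Hypotheses (exN : short_exact i p) (exM : short_exact j q).
Hypotheses (prP : projective P) (prF : projective F).
Hypothesis prN : projective (left_mod N).

Lemma shift_right : tensor_projective K M -> tensor_projective N M'.
Proof.
move=> tpK X Y g b gS bb.
have [jI qS qE] := exM; have [iI pS pE] := exN.
have qj x : q (j x) = 0 by apply/qE; exists x.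
have pi x : p (i x) = 0 by apply/pE; exists x.
have [c cB cE] := projective_extend_balanced prP jI (balanced_mapl p bb).
have [|d dB dE] := balanced_factorr exM (balanced_mapl i cB).
  by move=> n x; rewrite cE pi (balanced0l _ bb).
have [e eB eE] := tpK X Y g d gS dB.
have [h hB hE] := extend_balanced_left exN prN prF (balanced_mapr q eB).
have [|l lB lE] := @balanced_factorl _ _ _ _ _ F Y
  (fun n m => g (h n m) - c n m) exN (balanced_sub (balanced_comp g hB) cB).
  by move=> x m; rewrite hE eE dE subrr.
have [l' l'B l'E] := tensor_projective_left prN prF gS lB.
have [|z zB zE] := @balanced_factorl _ _ _ _ _ M' X
  (fun n m => h n (j m) - l' (p n) (j m)) exN
  (balanced_mapr j (balanced_sub hB (balanced_mapl p l'B))).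
  by move=> x m; rewrite hE qj pi (balanced0r _ eB) (balanced0l _ l'B) subrr.
exists z => // n m; have [x <-] := pS n.
by rewrite zE linearB l'E lE cE opprB addrC subrK.
Qed.

Lemma shift_left : tensor_projective N M' -> tensor_projective K M.
Proof.
move=> tpN X Y g b gS bb.
have [jI qS qE] := exM; have [iI pS pE] := exN.
have qj x : q (j x) = 0 by apply/qE; exists x.
have pi x : p (i x) = 0 by apply/pE; exists x.
have [c cB cE] := extend_balanced_left exN prN prF (balanced_mapr q bb).
have [|d dB dE] := balanced_factorl exN (balanced_mapr j cB).
  by move=> n x; rewrite cE qj (balanced0r _ bb).
have [e eB eE] := tpN X Y g d gS dB.
have [h hB hE] := projective_extend_balanced prP jI (balanced_mapl p eB).
have [|l lB lE] := @balanced_factorr _ _ _ _ _ P Y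
  (fun n m => g (h n m) - c n m) exM (balanced_sub (balanced_comp g hB) cB).
  by move=> x m; rewrite hE eE dE subrr.
have [l' l'B l'E] := projective_lift_balanced prP gS lB.
have [|z zB zE] := @balanced_factorr _ _ _ _ _ K X
  (fun n m => h (i n) m - l' (i n) (q m)) exM
  (balanced_mapl i (balanced_sub hB (balanced_mapr q l'B))).
  by move=> x m; rewrite hE qj pi (balanced0l _ eB) (balanced0r _ l'B) subrr.
exists z => // n m; have [x <-] := qS m.
by rewrite zE linearB l'E lE cE opprB addrC subrK.
Qed.

End Shift.

Lemma tensor_projective_iso (N N' : lmodType E) (M : lmodType A)
    (f : {linear N -> N'}) :
  bijective f -> tensor_projective N' M -> tensor_projective N M.
Proof.
move=> [f' fK f'K] tp X Y g b gS [bl br ba bb].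
have fD x y : f' (x + y) = f' x + f' y.
  by apply: (can_inj fK); rewrite linearD !f'K.
have fZ e x : f' (e *: x) = e *: f' x.
  by apply: (can_inj fK); rewrite linearZ_LR !f'K.
have [|c cB cE] := tp X Y g (fun n m => b (f' n) m) gS.
  by split=> [m x y|n x y|a n m|a n m]; rewrite ?fD ?fZ ?bl ?br ?ba ?bb.
exists (fun n m => c (f n) m); first exact: (balanced_mapl f cB).
by move=> n m; rewrite cE fK.
Qed.

(** Each step of [shift_right] or [shift_left] takes the last syzygy from the
    bimodule and puts a first syzygy on the module. *)
Lemma tensor_projective_syzygy m (N N' : lmodType E) (M M' : lmodType A) :
  is_nth_syzygy m N N' -> chain_syzygy m M M' -> projective (left_mod N) ->
  projective (left_mod N') /\ (tensor_projective N' M <-> tensor_projective N M').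
Proof.
elim: m N' M => [|m IH] N' M /=.
  move=> [f fB] -> prN; have [f' fK f'K] := fB; split.
    have [|F FE] := @linear_map_of A (left_mod N) (left_mod N') f.
      by move=> a x y; rewrite !scalar_restrE linearP.
    apply: (@projective_iso _ _ _ F) => //.
    by exists f' => x; rewrite FE ?fK ?f'K.
  have [|F FE] := @linear_map_of E N' N f'.
    by move=> a x y; apply: (can_inj fK); rewrite linearP !f'K.
  split; first exact: tensor_projective_iso fB.
  by apply: (@tensor_projective_iso _ _ _ F); exists f => x; rewrite FE ?fK ?f'K.
move=> [K NK [P [p [i [[prP pS _] iI pE]]]]] [M1 [F [j [q [prF exM M1M']]]]] prN.
have [prK tpK] := IH _ _ NK M1M' prN.
have exN : short_exact i p by [].
split; first by apply: projective_left_kernel exN prK (projective_left prP).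
by rewrite -tpK; split; [apply: shift_right exN exM _ _ _ | apply: shift_left exN exM _ _ _].
Qed.

(** * The bound on the finitistic dimension *)

(** Periodicity trades N (x) M for N (x) M', where M' is a p-th syzygy of M and
    has a resolution shorter by p, until the module is projective. *)
Lemma tensor_projective_periodic p (N : lmodType E) (M : lmodType A) d :
  (0 < p)%N -> is_nth_syzygy p N N -> projective (left_mod N) ->
  has_resolution_of_length M d -> tensor_projective N M.
Proof.
move=> p0 NN prN; elim/ltn_ind: d M => d IH M resM.
have [d0|d0] := posnP d.
  move: resM; rewrite d0 => /resolution_projective; exact: tensor_projective_left.
have [M' MM' resM'] := chain_syzygy_exists p resM.
have [_ [_]] := tensor_projective_syzygy NN MM' prN; apply.
by apply: IH resM'; rewrite ltn_subrL p0.
Qed.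

(** N0 is the regular bimodule A, through the identification u. *)
Section Regular.
Variables (N0 : lmodType E) (u : N0 -> A).
Hypotheses (uB : bijective u) (uD : {morph u : x y / x + y}).
Hypothesis ul : forall a x, u (lam a *: x) = a * u x.
Hypothesis ur : forall a x, u (rho a *: x) = u x * a.

Lemma regular_left_projective : projective (left_mod N0).
Proof.
have [v uK vK] := uB.
have [|F FE] := @linear_map_of A A^o (left_mod N0) v.
  by move=> a x y; apply: (can_inj uK); rewrite vK uD ul !vK.
apply: (@projective_iso _ _ _ F); last exact: regular_projective.
by exists u => x; rewrite FE ?uK ?vK.
Qed.

(** A (x) M = M. *)
Lemma tensor_regular_projective M : tensor_projective N0 M -> projective M.
Proof.
move=> tp X Y g f gS; have [v uK vK] := uB.
have [|c [cl cr ca cb] cE] := tp X Y g (fun x m => u x *: f m) gS.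
  split=> [m x y|n x y|a n m|a n m].
  - by rewrite uD scalerDl.
  - by rewrite linearD scalerDr.
  - by rewrite ul scalerA.
  - by rewrite ur linearZ_LR scalerA.
have [|F FE] := @linear_map_of A M X (c (v 1)).
  move=> a x y; rewrite cr -cb -ca; congr (c _ _ + _).
  by apply: (can_inj uK); rewrite ul ur vK mulr1 mul1r.
by exists F => m; rewrite FE cE vK scale1r.
Qed.

Lemma eventually_periodic_Fin_dim n p :
  eventually_periodic_module n p N0 -> (Fin_dim A <= (n%:Z)%:E)%E.
Proof.
move=> [[N N0N [p0 NN _]] _]; apply: Fin_dim_le => M d resM.
have [M' MM' _] := chain_syzygy_exists n resM.
have [prN [tpN _]] := tensor_projective_syzygy N0N MM' regular_left_projective.
rewrite -[n]addn0; apply: chain_syzygy_resolution MM' _.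
apply: projective_resolution0; apply: tensor_regular_projective; apply: tpN.
exact: tensor_projective_periodic p0 NN prN resM.
Qed.

End Regular.
End Bimodules.

(** * The enveloping algebra *)

Section TensorModules.
Variables (k : fieldType) (A B : falgType k).

Definition tensor_inl (a : A) : tensor A B := tens a 1.
Definition tensor_inr (b : B) : tensor A B := tens 1 b.

Let inl_linear : linear tensor_inl := (tens_bilinear A B).1 1.
Let inr_linear : linear tensor_inr := (tens_bilinear A B).2 1.

Let inl_monoid : monoid_morphism tensor_inl.
Proof. by split=> // a a'; rewrite /tensor_inl tensM mulr1. Qed.
Let inr_monoid : monoid_morphism tensor_inr.
Proof. by split=> // b b'; rewrite /tensor_inr tensM mulr1. Qed.

HB.instance Definition _ := GRing.isLinear.Build k A _ _ tensor_inl inl_linear.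
HB.instance Definition _ := GRing.isLinear.Build k B _ _ tensor_inr inr_linear.
HB.instance Definition _ := GRing.isMonoidMorphism.Build A _ tensor_inl inl_monoid.
HB.instance Definition _ := GRing.isMonoidMorphism.Build B _ tensor_inr inr_monoid.

Lemma tens_inl_inr a b : tens a b = tensor_inl a * tensor_inr b.
Proof. by rewrite tensM mulr1 mul1r. Qed.

Lemma tensor_linear (N N' : lmodType (tensor A B)) (f : N -> N') :
  {morph f : x y / x + y} ->
  (forall a x, f (tensor_inl a *: x) = tensor_inl a *: f x) ->
  (forall b x, f (tensor_inr b *: x) = tensor_inr b *: f x) -> linear f.
Proof.
move=> fD fl fr t x y; rewrite fD; congr (_ + _).
have f0 : f 0 = 0 by apply: (@addIr _ (f 0)); rewrite -fD !add0r.
rewrite [t]tensor_decomp !scaler_suml (big_morph f fD f0); apply: eq_bigr => i _.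
rewrite !scaler_suml (big_morph f fD f0); apply: eq_bigr => j _.
by rewrite tens_inl_inr scalerAl -linearZ_LR -!scalerA fl fr.
Qed.

(** Commuting actions of A and B on a subspace S give S a structure of module over
    the tensor product of A and B. *)
Section PartialModule.
Variables (V : lmodType k) (S : V -> Prop).
Variables (l : A -> V -> V) (r : B -> V -> V).
Hypothesis S0 : S 0.
Hypothesis SP : forall c x y, S x -> S y -> S (c *: x + y).
Hypotheses (Sl : forall a x, S x -> S (l a x)) (Sr : forall b x, S x -> S (r b x)).
Hypotheses (lL : forall a, linear (l a)) (rL : forall b, linear (r b)).
Hypothesis lLa : forall x, S x -> linear (l^~ x).
Hypothesis rLb : forall x, S x -> linear (r^~ x).
Hypotheses (l1 : forall x, l 1 x = x) (r1 : forall x, r 1 x = x).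
Hypothesis lM : forall a a' x, l a (l a' x) = l (a * a') x.
Hypothesis rM : forall b b' x, r b (r b' x) = r (b * b') x.
Hypothesis lr : forall a b x, l a (r b x) = r b (l a x).

Let act (t : tensor A B) (x : V) : V := tensor_lift (fun a b => l a (r b x)) t.

Let bil x : S x -> bilinear2 (fun a b => l a (r b x)).
Proof.
move=> Sx; split=> [b|a] c y z /=; first by rewrite lLa //; apply: Sr.
by rewrite rLb // lL.
Qed.

Let act_tens a b x : S x -> act (tens a b) x = l a (r b x).
Proof. by move=> Sx; rewrite /act tensor_lift_tens //; apply: bil. Qed.

Let act_linear t : linear (act t).
Proof.
move=> c x y; rewrite /act -tensor_lift_comb; apply: eq_tensor_lift => a b.
by rewrite rL lL.
Qed.

Let S_act t x : S x -> S (act t x).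
Proof.
have SD u v : S u -> S v -> S (u + v).
  by move=> Su Sv; have := SP 1 Su Sv; rewrite scale1r.
have SZ c u : S u -> S (c *: u) by move=> Su; have := SP c Su S0; rewrite addr0.
move=> Sx; apply: (big_ind S) => // i _; apply: (big_ind S) => // j _.
by apply/SZ/Sl/Sr.
Qed.

Let actA s t x : S x -> act s (act t x) = act (s * t) x.
Proof.
move=> Sx; move: s; apply: tensor_ext.
- exact: tensor_lift_linear.
- exact: (linear_comp (tensor_lift_linear _) (tensor_mul_linearl t)).
move=> a b; rewrite act_tens; last exact: S_act.
move: t; apply: tensor_ext.
- exact: (linear_comp (lL a) (linear_comp (rL b) (tensor_lift_linear _))).
- exact: (linear_comp (tensor_lift_linear _) (tensor_mul_linearr (tens a b))).
by move=> a' b'; rewrite tensM !act_tens // -lM -rM -lr.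
Qed.

Lemma tensor_module : exists (U : lmodType (tensor A B)) (ev : U -> V),
  [/\ injective ev, forall u, S (ev u), forall v, S v -> exists u, ev u = v,
      {morph ev : x y / x + y}
    & forall a b u, ev (tens a b *: u) = l a (r b (ev u))].
Proof.
have [|||||||U [ev [evI evS evE evD evZ]]] := @sub_module (tensor A B) V S act.
- exact: S0.
- by move=> x y Sx Sy; rewrite -scaleN1r addrC; apply: SP.
- exact: S_act.
- exact: actA.
- by move=> x Sx; rewrite -tens11 act_tens // l1 r1.
- by move=> t x y _ _; have := act_linear t 1 x y; rewrite !scale1r.
- move=> s t x _; have := tensor_lift_linear (fun a b => l a (r b x)) 1 s t.
  by rewrite !scale1r.
by exists U, ev; split=> // a b u; rewrite evZ act_tens.
Qed.

End PartialModule.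
End TensorModules.

(** The two actions of C on the functions from M to X.  Precomposition is additive
    in the scalar only on linear functions. *)
Section LinearFunctions.
Variables (k : fieldType) (C : algType k) (M X : lmodType C).
Local Notation V := (over_k M -> over_k X).

Definition post_scale (a : C) (f : V) : V := fun m => (a *: (f m : X) : X).
Definition pre_scale (a : C) (f : V) : V := fun m => f (a *: (m : M) : M).

Lemma linear_fun0 : linear (0 : V).
Proof. by move=> c x y; rewrite scaler0 addr0. Qed.

Lemma linear_funP c (f g : V) : linear f -> linear g -> linear (c *: f + g).
Proof.
move=> fL gL d x y; rewrite !fctE fL gL.
by rewrite !scalerDr !scalerA addrACA (mulrC c d).
Qed.

Lemma post_scale_fun a (f : V) : linear f -> linear (post_scale a f).
Proof.
move=> fL c x y; rewrite /post_scale fL !scalar_restrE scalerDr !scalerA.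
by rewrite /= mulr_algl mulr_algr.
Qed.

Lemma pre_scale_fun a (f : V) : linear f -> linear (pre_scale a f).
Proof.
move=> fL c x y; rewrite /pre_scale -fL; congr (f _).
by rewrite !scalar_restrE scalerDr !scalerA /= mulr_algl mulr_algr.
Qed.

Lemma post_scale_linear a : linear (post_scale a).
Proof.
move=> c f g; apply: funext => m; rewrite /post_scale !fctE !scalar_restrE.
by rewrite scalerDr !scalerA /= mulr_algl mulr_algr.
Qed.

Lemma pre_scale_linear a : linear (pre_scale a).
Proof. by []. Qed.

Lemma post_scale_linearl (f : V) : linear (post_scale^~ f).
Proof.
move=> c a a'; apply: funext => m; rewrite /post_scale !fctE !scalar_restrE.
by rewrite scalerDl scalerA /= mulr_algl.
Qed.

Lemma pre_scale_linearl (f : V) : linear f -> linear (pre_scale^~ f).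
Proof.
move=> fL c a a'; apply: funext => m; rewrite /pre_scale !fctE -fL; congr (f _).
by rewrite !scalar_restrE scalerDl scalerA /= mulr_algl.
Qed.

Lemma post_scale1 (f : V) : post_scale 1 f = f.
Proof. by apply: funext => m; rewrite /post_scale scale1r. Qed.

Lemma pre_scale1 (f : V) : pre_scale 1 f = f.
Proof. by apply: funext => m; rewrite /pre_scale scale1r. Qed.

Lemma post_scaleM a a' (f : V) :
  post_scale a (post_scale a' f) = post_scale (a * a') f.
Proof. by apply: funext => m; rewrite /post_scale scalerA. Qed.

Lemma pre_scaleM a a' (f : V) :
  pre_scale a (pre_scale a' f) = pre_scale (a' * a) f.
Proof. by apply: funext => m; rewrite /pre_scale scalerA. Qed.

End LinearFunctions.

Section Enveloping.
Variables (k : fieldType) (L : falgType k).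

Definition env_left : {rmorphism L -> enveloping L} := @tensor_inl k L L^c.
Definition env_right : {rmorphism L^c -> enveloping L} := @tensor_inr k L L^c.

(** The ring structure of L^c^c is equal, but not convertible, to that of L. *)
Definition env_left_op (a : L^c^c) : enveloping L := env_left a.
Let env_left_op_zmod : zmod_morphism env_left_op.
Proof. exact: (rmorphB env_left). Qed.
Let env_left_op_monoid : monoid_morphism env_left_op.
Proof. by split; [exact: (rmorph1 env_left) | exact: (rmorphM env_left)]. Qed.
HB.instance Definition _ :=
  GRing.isZmodMorphism.Build L^c^c (enveloping L) env_left_op env_left_op_zmod.
HB.instance Definition _ :=
  GRing.isMonoidMorphism.Build L^c^c (enveloping L) env_left_op env_left_op_monoid.

Lemma env_left_right_comm a b : env_left a * env_right b = env_right b * env_left a.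
Proof. by rewrite /= /tensor_inl /tensor_inr !tensM !mulr1 !mul1r. Qed.

Lemma env_left_right_central (c : k) : env_left c%:A = env_right c%:A.
Proof.
exact: (etrans (linearZ_LR (@tensor_inl k L L^c) c 1)
  (esym (linearZ_LR (@tensor_inr k L L^c) c 1))).
Qed.

Lemma enveloping_ring_left : enveloping_ring env_left env_right.
Proof.
split=> [||N N' f fD fl fr|M X].
- exact: env_left_right_comm.
- exact: env_left_right_central.
- exact: tensor_linear.
have [||||||||||||| U [ev [evI evS evE evD evZ]]] :=
  @tensor_module k L L^c (over_k M -> over_k X) (fun f => linear f)
    (@post_scale k L M X) (@pre_scale k L M X).
- exact: linear_fun0.
- exact: linear_funP.
- exact: (@post_scale_fun k L M X).
- exact: (@pre_scale_fun k L M X).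
- exact: (@post_scale_linear k L M X).
- exact: (@pre_scale_linear k L M X).
- by move=> f _; apply: (@post_scale_linearl k L M X).
- exact: (@pre_scale_linearl k L M X).
- exact: (@post_scale1 k L M X).
- exact: (@pre_scale1 k L M X).
- exact: (@post_scaleM k L M X).
- by move=> b b' f; apply: (@pre_scaleM k L M X).
- by [].
exists U, ev; split=> [|u v uv|f].
- split=> [m x y|u x y|a u m|b u m].
  + by rewrite evD.
  + by have := evS u 1 x y; rewrite !scale1r.
  + by rewrite evZ /post_scale /pre_scale scale1r.
  + by rewrite evZ /post_scale /pre_scale scale1r.
- by apply: evI; apply: funext.
- have [|v vE] := evE f; first by move=> c x y; apply: linearP.
  by exists v => n; rewrite vE.
Qed.

(** Right modules: L^c acts on the left through the right factor, and on the
    right through the left factor. *)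
Lemma enveloping_ring_right :
  enveloping_ring (A := L^c) env_right env_left_op.
Proof.
split=> [a b|c|N N' f fD fr fl|M X].
- by rewrite env_left_right_comm.
- by rewrite -env_left_right_central.
- exact: tensor_linear.
have [||||||||||||| U [ev [evI evS evE evD evZ]]] :=
  @tensor_module k L L^c (over_k M -> over_k X) (fun f => linear f)
    (@pre_scale k L^c M X) (@post_scale k L^c M X).
- exact: linear_fun0.
- exact: linear_funP.
- exact: (@pre_scale_fun k L^c M X).
- exact: (@post_scale_fun k L^c M X).
- exact: (@pre_scale_linear k L^c M X).
- exact: (@post_scale_linear k L^c M X).
- exact: (@pre_scale_linearl k L^c M X).
- by move=> f _; apply: (@post_scale_linearl k L^c M X).
- exact: (@pre_scale1 k L^c M X).
- exact: (@post_scale1 k L^c M X).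
- by move=> a a' f; apply: (@pre_scaleM k L^c M X).
- exact: (@post_scaleM k L^c M X).
- by [].
exists U, ev; split=> [|u v uv|f].
- split=> [m x y|u x y|a u m|b u m].
  + by rewrite evD.
  + by have := evS u 1 x y; rewrite !scale1r.
  + by rewrite evZ /post_scale /pre_scale scale1r.
  + by rewrite evZ /post_scale /pre_scale scale1r.
- by apply: evI; apply: funext.
- have [|v vE] := evE f; first by move=> c x y; apply: linearP.
  by exists v => n; rewrite vE.
Qed.

End Enveloping.

Theorem proposition5p4 (k : fieldType) (L : falgType k) (n p : nat)
  (hL : eventually_periodic_algebra n p L) :
  (Fin_dim L <= (n%:Z)%:E)%E /\ (Fin_dim L^c <= (n%:Z)%:E)%E.
Proof.
have idB : bijective (id : L -> L) by exists id.
split.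
  apply: (eventually_periodic_Fin_dim (enveloping_ring_left L)
    (u := id : regular_bimodule L -> L) _ _ _ _ hL) => //.
    by move=> a x; apply: etrans (bimodule_scale_tens a 1 x) (mulr1 _).
  by move=> a x; apply: etrans (bimodule_scale_tens 1 a x) _; rewrite mul1r.
apply: (eventually_periodic_Fin_dim (enveloping_ring_right L)
  (u := id : regular_bimodule L -> L^c) _ _ _ _ hL) => //.
  by move=> a x; apply: etrans (bimodule_scale_tens 1 a x) _; rewrite mul1r.
by move=> a x; apply: etrans (bimodule_scale_tens a 1 x) (mulr1 _).
Qed.
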